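(* Let $M\ge2$. Observe $\mathbf y=\mathbf f+\boldsymbol\xi$ with $\xi_1,\dots,\xi_n$ i.i.d. $\mathcal N(0,\sigma^2)$. For $j=1,\dots,M$ let $\hat{\boldsymbol\mu}_j=A_j\mathbf y+\mathbf b_j$ with deterministic $\mathbf b_j\in\mathbf R^n$ and deterministic $n\times n$ matrices satisfying $A_j=A_j^T=A_j^2$. Let $\hat\sigma^2$ be an estimator with $\delta:=\mathbb P(|\sigma^2-\hat\sigma^2|>\sigma^2/8)<1$. Let $\hat{\boldsymbol\theta}_{\hat\sigma}\in\arg\min_{\boldsymbol\theta\in\Lambda^M}W_{\mathrm{pen}}(\boldsymbol\theta)$ where \[W_{\mathrm{pen}}(\boldsymbol\theta)=\|\hat{\boldsymbol\mu}_{\boldsymbol\theta}\|_2^2-2\mathbf y^T\hat{\boldsymbol\mu}_{\boldsymbol\theta}+2\hat\sigma^2\mathrm{Tr}(A_{\boldsymbol\theta})+\tfrac12\mathrm{pen}(\boldsymbol\theta).\] Then for all $x>0$, with probability at least $1-\delta-2e^{-x}$, \[\|\hat{\boldsymbol\mu}_{\hat{\boldsymbol\theta}_{\hat\sigma}}-\mathbf f\|_2^2\le\min_{j=1,\dots,M}\|\hat{\boldsymbol\mu}_j-\mathbf f\|_2^2+64\sigma^2(x+2\log M).\]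
   Context: $\Lambda^M=\{\boldsymbol\theta\in\mathbf R^M:\sum_j\theta_j=1,\theta_j\ge0\}$. For $\boldsymbol\theta\in\Lambda^M$: $A_{\boldsymbol\theta}=\sum_j\theta_jA_j$, $\mathbf b_{\boldsymbol\theta}=\sum_j\theta_j\mathbf b_j$, $\hat{\boldsymbol\mu}_{\boldsymbol\theta}=A_{\boldsymbol\theta}\mathbf y+\mathbf b_{\boldsymbol\theta}$, and $\mathrm{pen}(\boldsymbol\theta)=\sum_j\theta_j\|\hat{\boldsymbol\mu}_{\boldsymbol\theta}-\hat{\boldsymbol\mu}_j\|_2^2$. *)

(* Defs.v *)
From HB Require Import structures.
From mathcomp Require Import all_boot all_order all_algebra.
From mathcomp Require Import all_classical all_reals all_analysis.
Set Implicit Arguments. Unset Strict Implicit. Unset Printing Implicit Defensive.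
Import Order.TTheory GRing.Theory Num.Theory.
Local Open Scope ring_scope.
Local Open Scope classical_set_scope.

Section Aggregation.
Variables (R : realType) (n M : nat).

Definition dotv (u v : 'cV[R]_n) : R := \sum_(i < n) u i 0 * v i 0.
Definition sqnorm (v : 'cV[R]_n) : R := dotv v v.

Definition in_simplex (theta : 'I_M -> R) : Prop :=
  (forall j, 0 <= theta j) /\ \sum_(j < M) theta j = 1.

Variables (A : 'I_M -> 'M[R]_n) (b : 'I_M -> 'cV[R]_n).

Definition A_th (theta : 'I_M -> R) : 'M[R]_n := \sum_(j < M) theta j *: A j.
Definition b_th (theta : 'I_M -> R) : 'cV[R]_n := \sum_(j < M) theta j *: b j.
Definition mu_j (y : 'cV[R]_n) (j : 'I_M) : 'cV[R]_n := A j *m y + b j.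
Definition mu_th (y : 'cV[R]_n) (theta : 'I_M -> R) : 'cV[R]_n :=
  A_th theta *m y + b_th theta.
Definition pen (y : 'cV[R]_n) (theta : 'I_M -> R) : R :=
  \sum_(j < M) theta j * sqnorm (mu_th y theta - mu_j y j).
Definition Wpen (y : 'cV[R]_n) (s2 : R) (theta : 'I_M -> R) : R :=
  sqnorm (mu_th y theta) - 2 * dotv y (mu_th y theta)
  + 2 * s2 * \tr (A_th theta) + pen y theta / 2.
End Aggregation.

(* mutual independence of a finite family of real random variables:
   product rule for all measurable sets (taking some B i = setT gives
   every subfamily) *)
Definition mutually_independent (d : measure_display) (T : measurableType d)
  (R : realType) (P : probability T R) (n : nat) (X : 'I_n -> T -> R) : Prop :=
  forall B : 'I_n -> set R, (forall i, measurable (B i)) ->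
    P (\bigcap_(i in [set: 'I_n]) (X i @^-1` B i)) =
    (\prod_(i < n) P (X i @^-1` B i))%E.

(* Main.v *)
(** Write [D = A_j - A_k] and [v = D f + b_j - b_k].  On the simplex [Wpen] is
    [|mu_theta|^2 / 2] plus a linear function, so a minimiser [theta] satisfies
    [Wpen theta + |mu_theta - mu_k|^2 / 2 <= Wpen e_k], and hence
    [|mu_theta - f|^2 - |mu_k - f|^2] is at most the [theta]-average over [j] of
    [2 xi.(mu_j - mu_k) - 2 s2hat Tr D - |mu_j - mu_k|^2 / 2].  When
    [|s2hat - sigma^2| <= sigma^2 / 8], the inequality [|Tr D| <= Tr D^2] for
    differences of orthogonal projections bounds this by
    [Z_jk = 2 xi.(D xi + v) - |D xi + v|^2 / 2 - 2 sigma^2 Tr D + sigma^2 Tr D^2 / 4].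
    The negative square makes [E exp (Z_jk / (64 sigma^2)) <= 1], and Markov's
    inequality with a union bound over the [M^2] pairs concludes.

    The Gaussian integral is handled without diagonalising [D]: for [S]
    symmetric positive definite with inverse [X] and [g] standard Gaussian,
    [E exp ((|g|^2 - g.S g) / 2 + l.g) <= exp (Tr (X - 1) / 2 + l.X l / 2)], by
    integrating one coordinate at a time. *)

Require Import Defs.
From HB Require Import structures.
From mathcomp Require Import all_boot all_order all_algebra.
From mathcomp Require Import all_classical all_reals all_analysis.
From mathcomp Require Import measurable_realfun ring lra.
Set Implicit Arguments. Unset Strict Implicit. Unset Printing Implicit Defensive.
Import Order.TTheory GRing.Theory Num.Theory.
Local Open Scope ring_scope.
Local Open Scope classical_set_scope.

(** * Euclidean inner product and orthogonal projections *)

Section EuclideanVectors.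
Variables (R : realType) (n : nat).
Implicit Types (u v w : 'cV[R]_n) (A P Q D : 'M[R]_n).

Lemma dotvE u v : dotv u v = (u^T *m v) 0 0.
Proof. by rewrite mxE; apply: eq_bigr => i _; rewrite mxE. Qed.

Lemma dotvC u v : dotv u v = dotv v u.
Proof. by apply: eq_bigr => i _; rewrite mulrC. Qed.

Lemma dotvDr u v w : dotv u (v + w) = dotv u v + dotv u w.
Proof. by rewrite !dotvE mulmxDr mxE. Qed.

Lemma dotvDl u v w : dotv (v + w) u = dotv v u + dotv w u.
Proof. by rewrite dotvC dotvDr !(dotvC u). Qed.

Lemma dotvZr a u v : dotv u (a *: v) = a * dotv u v.
Proof. by rewrite !dotvE -scalemxAr mxE. Qed.

Lemma dotvZl a u v : dotv (a *: u) v = a * dotv u v.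
Proof. by rewrite dotvC dotvZr dotvC. Qed.

Lemma dotvNr u v : dotv u (- v) = - dotv u v.
Proof. by rewrite -scaleN1r dotvZr mulN1r. Qed.

Lemma dotvNl u v : dotv (- u) v = - dotv u v.
Proof. by rewrite dotvC dotvNr dotvC. Qed.

Lemma dotv_sumr (I : finType) u (F : I -> 'cV[R]_n) :
  dotv u (\sum_i F i) = \sum_i dotv u (F i).
Proof. by rewrite dotvE mulmx_sumr summxE; apply: eq_bigr => i _; rewrite dotvE. Qed.

Lemma dotv_adj A u v : dotv (A *m u) v = dotv u (A^T *m v).
Proof. by rewrite !dotvE trmx_mul mulmxA. Qed.

Definition dotvS := (dotvDl, dotvDr, dotvNl, dotvNr, dotvZl, dotvZr).

Lemma sqnorm_ge0 v : 0 <= sqnorm v.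
Proof. by apply: sumr_ge0 => i _; rewrite -expr2 sqr_ge0. Qed.

Lemma dotvBr u v w : dotv u (v - w) = dotv u v - dotv u w.
Proof. by rewrite dotvDr dotvNr. Qed.

Lemma sqnormB u v : sqnorm (u - v) = sqnorm u - 2 * dotv u v + sqnorm v.
Proof. by rewrite /sqnorm !dotvS (dotvC v u); ring. Qed.

Lemma sqnormZ a v : sqnorm (a *: v) = a ^+ 2 * sqnorm v.
Proof. by rewrite /sqnorm !dotvS; ring. Qed.

Lemma sqnorm_segment u v t : sqnorm ((1 - t) *: u + t *: v) =
  (1 - t) * sqnorm u + t * sqnorm v - t * (1 - t) * sqnorm (u - v).
Proof. by rewrite /sqnorm !dotvS (dotvC v u); ring. Qed.

Lemma sqnorm_eq0 v : sqnorm v = 0 -> v = 0.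
Proof.
move=> /eqP; rewrite psumr_eq0 => [/allP v0|i _]; last by rewrite -expr2 sqr_ge0.
apply/matrixP => i j; rewrite mxE ord1; apply/eqP.
by have := v0 i (mem_index_enum i); rewrite mulf_eq0 orbb.
Qed.

Lemma mxtrace_gram A B : \tr (A^T *m B) = \sum_j dotv (col j A) (col j B).
Proof. by apply: eq_bigr => j _; rewrite mxE; apply: eq_bigr => k _; rewrite !mxE. Qed.

Lemma col_mul A B (j : 'I_n) : col j (A *m B) = A *m col j B.
Proof. by rewrite !colE mulmxA. Qed.

Definition orthoproj P := P = P^T /\ P *m P = P.

Lemma orthoproj_dotv P w : orthoproj P -> dotv w (P *m w) = sqnorm (P *m w).
Proof. by move=> [Ps Pi]; rewrite /sqnorm dotv_adj -Ps mulmxA Pi. Qed.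

Lemma orthoproj_sqnorm_le P w : orthoproj P -> sqnorm (P *m w) <= sqnorm w.
Proof.
move=> hP; have := sqnorm_ge0 (w - P *m w).
rewrite /sqnorm !dotvS (dotvC (P *m w) w) orthoproj_dotv // /sqnorm; lra.
Qed.

Lemma orthoproj_compl P : orthoproj P -> orthoproj (1%:M - P).
Proof.
move=> [Ps Pi]; split; first by rewrite linearB /= trmx1 -Ps.
by rewrite mulmxBr !mulmxBl !mul1mx mulmx1 Pi subrr subr0.
Qed.

Lemma orthoprojB_dotv_le P Q w : orthoproj P -> orthoproj Q ->
  - sqnorm w <= dotv w ((P - Q) *m w) <= sqnorm w.
Proof.
move=> hP hQ; rewrite mulmxBl dotvDr dotvNr !orthoproj_dotv //.
have := orthoproj_sqnorm_le w hP; have := orthoproj_sqnorm_le w hQ.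
have := sqnorm_ge0 (P *m w); have := sqnorm_ge0 (Q *m w); lra.
Qed.

(* [(P - Q) w] is the difference of the orthogonal vectors [P (w - Q w)] and
   [(1 - P) Q w]. *)
Lemma orthoprojB_sqnorm_le P Q w : orthoproj P -> orthoproj Q ->
  sqnorm ((P - Q) *m w) <= sqnorm w.
Proof.
move=> hP hQ.
pose a := P *m (w - Q *m w); pose b := (1%:M - P) *m (Q *m w).
have -> : (P - Q) *m w = a - b.
  rewrite /a /b mulmxBr !mulmxBl !mul1mx; apply/matrixP => i j; rewrite !mxE; ring.
have ab : dotv a b = 0.
  case: hP => Ps Pi.
  rewrite /a dotv_adj -Ps /b mulmxA mulmxBr mulmx1 Pi subrr mul0mx.
  by rewrite -(scale0r 0) dotvZr mul0r.
have ha : sqnorm a <= sqnorm (w - Q *m w) by apply: orthoproj_sqnorm_le.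
have hb : sqnorm b <= sqnorm (Q *m w) by apply/orthoproj_sqnorm_le/orthoproj_compl.
move: ha hb ab; rewrite /sqnorm !dotvS (dotvC (Q *m w) w) orthoproj_dotv // /sqnorm.
by rewrite (dotvC b a); lra.
Qed.

(** The left side is the squared Frobenius norm of [Q *m P], and [Q] contracts each column of
    [P]. *)
Lemma orthoprojM_mxtrace_le P Q : orthoproj P -> orthoproj Q ->
  \tr (P *m Q) <= \tr P.
Proof.
move=> hP hQ; case: (hP) (hQ) => Ps Pi [Qs Qi].
have -> : \tr (P *m Q) = \tr ((Q *m P)^T *m (Q *m P)).
  by rewrite trmx_mul -Ps -Qs mulmxA -(mulmxA P Q Q) Qi [RHS]mxtrace_mulC mulmxA Pi.
have -> : \tr P = \tr (P^T *m P) by rewrite -Ps Pi.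
rewrite !mxtrace_gram; apply: ler_sum => j _.
by rewrite col_mul; apply: orthoproj_sqnorm_le.
Qed.

(** Since [Tr (P - Q)^2 = Tr P + Tr Q - 2 Tr (P Q)], subtracting [Tr (P - Q)] or its opposite leaves
    [2 (Tr Q - Tr (P Q))] or [2 (Tr P - Tr (P Q))], both nonnegative. *)
Lemma orthoprojB_mxtrace_le P Q : orthoproj P -> orthoproj Q ->
  `|\tr (P - Q)| <= \tr ((P - Q) *m (P - Q)).
Proof.
move=> hP hQ; have tPQ := orthoprojM_mxtrace_le hP hQ.
have tQP := orthoprojM_mxtrace_le hQ hP.
case: hP hQ => Ps Pi [Qs Qi].
rewrite mulmxBr !mulmxBl Pi Qi !raddfB /= in tPQ tQP *.
rewrite [\tr (Q *m P)]mxtrace_mulC in tQP *.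
by rewrite ler_norml; apply/andP; split; lra.
Qed.

(** * Inverse of a coercive matrix *)

Section InverseBounds.
Variables (c : R) (S X : 'M[R]_n).
Hypotheses (c_gt0 : 0 < c) (S_ge : forall v, c * sqnorm v <= dotv v (S *m v)).

Lemma coercive_unitmx : S \in unitmx.
Proof.
rewrite -unitmx_tr -row_free_unit; apply: inj_row_free => w w0.
have Sw : S *m w^T = 0 by rewrite -[S]trmxK -trmx_mul w0 trmx0.
have := S_ge w^T; rewrite Sw -(scale0r w^T) dotvZr mul0r => h.
have /sqnorm_eq0 : sqnorm w^T = 0.
  by apply/eqP; rewrite eq_le sqnorm_ge0 andbT; move: h; rewrite pmulr_rle0.
by move=> /(congr1 trmx); rewrite trmxK trmx0.
Qed.

Hypothesis SX : S *m X = 1%:M.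

Lemma coercive_inv_dotv_ge0 w : 0 <= dotv w (X *m w).
Proof.
have {1}-> : w = S *m (X *m w) by rewrite mulmxA SX mul1mx.
rewrite dotvC; apply: le_trans (S_ge _).
by rewrite mulr_ge0 ?sqnorm_ge0 // ltW.
Qed.

(** Expand [|w - c X w|^2 >= 0] and bound [c |X w|^2] by coercivity at [X w]. *)
Lemma coercive_inv_dotv_le w : c * dotv w (X *m w) <= sqnorm w.
Proof.
have e : w = S *m (X *m w) by rewrite mulmxA SX mul1mx.
have := S_ge (X *m w); rewrite -e (dotvC _ w) => h.
have := sqnorm_ge0 (w - c *: (X *m w)).
rewrite /sqnorm !dotvS (dotvC (X *m w) w) -/(sqnorm _) -/(sqnorm _).
move: h; rewrite -(ler_pM2l c_gt0); lra.
Qed.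

End InverseBounds.
End EuclideanVectors.

(** * One-dimensional Gaussian integrals *)

Section GaussianIntegral.
Variable R : realType.
Implicit Types (m s : R).

(** The Radon-Nikodym derivative of [normal_prob m s] has the same integral as [normal_pdf m s] over
    every measurable set, so the two agree almost everywhere. *)
Lemma ge0_integral_normal_prob m s (f : measurableTypeR R -> \bar R) :
  measurable_fun setT f -> (forall x, 0 <= f x)%E ->
  (\int[normal_prob m s]_x f x =
   \int[lebesgue_measure]_x (f x * (normal_pdf m s x)%:E))%E.
Proof.
move=> mf f0.
have dom := normal_prob_dominates m s.
rewrite -(Radon_Nikodym_SigmaFinite.change_of_variables dom f0 measurableT mf).
have mg := measurable_int _ (Radon_Nikodym_SigmaFinite.f_integrable dom).
have mp : measurable_fun setT (fun x : R => (normal_pdf m s x)%:E).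
  by apply/measurable_EFinP; exact: measurable_normal_pdf.
apply: ae_eq_integral => //; [exact: emeasurable_funM|exact: emeasurable_funM|].
apply: ae_eqe_mul2l.
apply: integral_ae_eq => //.
  exact: Radon_Nikodym_SigmaFinite.f_integrable.
by move=> E _ mE; rewrite -Radon_Nikodym_SigmaFinite.f_integral.
Qed.

(** Completing the square: the integrand times the density of N(0, s^2) is a constant times the
    density of N(s a / q, s^2 / q). *)
Lemma integral_normal_prob_expR s (q a : R) : 0 < s -> 0 < q ->
  (\int[normal_prob 0 s]_x
     (expR ((1 - q) / 2 * (x / s) ^+ 2 + a * (x / s)))%:E =
   ((Num.sqrt q)^-1 * expR (a ^+ 2 / (2 * q)))%:E)%E.
Proof.
move=> s0 q0; rewrite ge0_integral_normal_prob; last 2 first.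
- apply/measurable_EFinP/measurableT_comp => //; apply: measurable_funD.
    apply: measurable_funM => //; apply: measurable_funX.
    exact: measurable_funM.
  by apply: measurable_funM => //; exact: measurable_funM.
- by move=> x; rewrite lee_fin expR_ge0.
pose t := s / Num.sqrt q; pose m := s * a / q.
have sq0 : 0 < Num.sqrt q by rewrite sqrtr_gt0.
have t0 : 0 < t by rewrite divr_gt0.
have t2 : t ^+ 2 = s ^+ 2 / q by rewrite exprMn exprVn sqr_sqrtr // ltW.
pose C := (Num.sqrt q)^-1 * expR (a ^+ 2 / (2 * q)).
have e x : expR ((1 - q) / 2 * (x / s) ^+ 2 + a * (x / s)) * normal_pdf 0 s x
  = C * normal_pdf m t x.
  rewrite !normal_pdfE ?gt_eqF // /normal_fun.
  have -> : normal_peak s = (Num.sqrt q)^-1 * normal_peak t.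
    rewrite /normal_peak t2 -invfM; congr (_^-1); rewrite -sqrtrM ?(ltW q0) //.
    by congr Num.sqrt; field; rewrite gt_eqF.
  rewrite /C t2 -!mulrA; rewrite [LHS]mulrCA; congr (_ * _).
  rewrite mulrCA [RHS]mulrCA; congr (_ * _).
  rewrite -!expRD; congr expR; rewrite /m; field; rewrite !gt_eqF //.
under eq_integral do rewrite -EFinM e EFinM.
rewrite ge0_integralZl //=.
- by rewrite integral_normal_pdf mule1.
- by apply/measurable_EFinP; exact: measurable_normal_pdf.
- by move=> x _; rewrite lee_fin normal_pdf_ge0.
- by rewrite lee_fin mulr_ge0 ?expR_ge0 // invr_ge0 ltW.
Qed.
End GaussianIntegral.

(** * Independence, product laws and Tonelli *)

Section Independence.
Context (d : measure_display) (T : measurableType d) (R : realType).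
Variable P : probability T R.

(** The joint law agrees with the product law on rectangles, hence everywhere; Tonelli then
    integrates [X] first. *)
Lemma ge0_integral_indep (d1 d2 : measure_display) (T1 : measurableType d1)
    (T2 : measurableType d2) (X : {mfun T >-> T1}) (Y : {mfun T >-> T2})
    (h : T1 * T2 -> \bar R) :
  (forall A B, measurable A -> measurable B ->
     P (X @^-1` A `&` Y @^-1` B) = P (X @^-1` A) * P (Y @^-1` B))%E ->
  measurable_fun setT h -> (forall z, 0 <= h z)%E ->
  (\int[P]_w h (X w, Y w) = \int[P]_w \int[distribution P X]_x h (x, Y w))%E.
Proof.
move=> indep mh h0.
have mXY : measurable_fun setT (fun w => (X w, Y w)) by exact: measurable_fun_pair.
transitivity (\int[pushforward P (fun w => (X w, Y w))]_z h z)%E.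
  by rewrite ge0_integral_pushforward.
transitivity (\int[distribution P X \x distribution P Y]_z h z)%E.
  apply: eq_measure_integral => A mA _; apply/esym.
  by apply: product_measure_unique => // B C mB mC; exact: indep.
rewrite fubini_tonelli2 // ge0_integral_distribution //.
  exact: measurable_fun_fubini_tonelli_G.
by move=> y; exact: integral_ge0.
Qed.

(* Rectangles generate the sigma-algebra of the family [Y] as a sub-sigma-algebra
   on [T] itself; integrating out a coordinate independent of [Y] then needs no
   measurable structure on vectors. *)
Definition rectangles (n : nat) (Y : 'I_n -> T -> R) : set (set T) :=
  [set E | exists2 B : 'I_n -> set R, (forall i, measurable (B i)) &
     E = \bigcap_(i in [set: 'I_n]) (Y i @^-1` B i)].

Lemma rectangles_measurable (n : nat) (Y : 'I_n -> T -> R) :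
  (forall i, measurable_fun setT (Y i)) -> rectangles Y `<=` measurable.
Proof.
move=> mY E [B mB ->]; apply: fin_bigcap_measurable => // i _.
by rewrite -[X in measurable X]setTI; exact: mY.
Qed.

Lemma rectangles_setI (n : nat) (Y : 'I_n -> T -> R) : setI_closed (rectangles Y).
Proof.
move=> E F [B mB ->] [C mC ->]; exists (fun i => B i `&` C i).
  by move=> i; exact: measurableI.
by rewrite -bigcapI.
Qed.

Lemma measurable_fun_rectangles (n : nat) (Y : 'I_n -> T -> R) (i : 'I_n) :
  measurable_fun setT (Y i : g_sigma_algebraType (rectangles Y) -> R).
Proof.
move=> _ B mB; rewrite setTI; apply: sub_sigma_algebra.
exists (fun k => if k == i then B else setT); first by move=> k; case: ifP.
apply/seteqP; split=> w /= => [Bw k _|/(_ i Logic.I)]; last by rewrite eqxx.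
by case: eqP => // ->.
Qed.

Section Family.
Variables (n : nat) (xi : 'I_n.+1 -> T -> R).
Hypothesis mxi : forall i, measurable_fun setT (xi i).
Hypothesis ixi : mutually_independent P xi.
Let Y (i : 'I_n) := xi (lift ord0 i).

Lemma mutually_independent_cons (A : set R) (B : 'I_n -> set R) :
  measurable A -> (forall i, measurable (B i)) ->
  (P (xi ord0 @^-1` A `&` \bigcap_(i in [set: 'I_n]) (Y i @^-1` B i)) =
   P (xi ord0 @^-1` A) * \prod_(i < n) P (Y i @^-1` B i))%E.
Proof.
move=> mA mB; pose C k := if unlift ord0 k is Some i then B i else A.
have mC k : measurable (C k) by rewrite /C; case: unliftP.
have := ixi mC; rewrite big_ord_recl {2}/C unlift_none.
rewrite (eq_bigr (fun i => P (Y i @^-1` B i))) => [<-|i _]; last by rewrite /C liftK.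
rewrite /C; congr (P _); apply/seteqP; split=> w /=.
  by move=> [Aw Bw] k _; case: unliftP => [i ->|->] //; exact: Bw.
move=> Cw; split; first by have := Cw ord0 Logic.I; rewrite unlift_none.
by move=> i _; have := Cw (lift ord0 i) Logic.I; rewrite liftK.
Qed.

Lemma mutually_independent_behead : mutually_independent P Y.
Proof.
move=> B mB; have := mutually_independent_cons measurableT mB.
by rewrite preimage_setT setTI probability_setT mul1e.
Qed.

(** As functions of [E], both sides are finite measures; they agree on the rectangles, which are
    stable under intersection and generate the sigma-algebra. *)
Lemma mutually_independent_rectangles (A : set R) (E : set T) :
  measurable A -> <<s rectangles Y >> E ->
  (P (xi ord0 @^-1` A `&` E) = P (xi ord0 @^-1` A) * P E)%E.
Proof.
move=> mA.
have mXA : measurable (xi ord0 @^-1` A).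
  by rewrite -[X in measurable X]setTI; exact: mxi.
have fP : P (xi ord0 @^-1` A) \is a fin_num by exact: fin_num_measure.
have f0 : 0 <= fine (P (xi ord0 @^-1` A)) by rewrite fine_ge0.
move=> sE; suff : mrestr P mXA E = mscale (NngNum f0) P E.
  by rewrite /mscale /mrestr /= fineK // setIC.
apply: (g_sigma_algebra_measure_unique (rectangles Y) _ (fun=> setT)) => //.
- by apply: rectangles_measurable => i; exact: mxi.
- by move=> _; exists (fun=> setT) => //; apply/seteqP; split.
- by apply/seteqP; split => // w _; exists 0%N.
- exact: rectangles_setI.
- move=> _ [B mB ->]; rewrite /= /mscale /mrestr /= fineK // setIC.
  by rewrite mutually_independent_cons // mutually_independent_behead.
- by move=> _; rewrite /= /mrestr setTI ltey_eq fP.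
Qed.
End Family.
End Independence.

(** * Schur complements and block inverses *)

Section SchurComplement.
Variables (R : realType) (n : nat).
Implicit Types (a b s : R) (u v r : 'cV[R]_n) (A : 'M[R]_n).

Definition consv a u : 'cV[R]_(1 + n) := col_mx (a%:M : 'M[R]_1) u.

Lemma consv_split (w : 'cV[R]_(1 + n)) : exists a u, w = consv a u.
Proof. by exists (usubmx w 0 0), (dsubmx w); rewrite /consv -mx11_scalar vsubmxK. Qed.

Lemma dotv_consv a u b v : dotv (consv a u) (consv b v) = a * b + dotv u v.
Proof.
rewrite !dotvE /consv (@tr_col_mx _ 1 n 1) (@mul_row_col _ 1 1 n 1) tr_scalar_mx.
by rewrite -scalar_mxM mxE !mxE eqxx mulr1n.
Qed.

Lemma mulmx_row_scalar r v : r^T *m v = (dotv r v)%:M.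
Proof. by rewrite [LHS]mx11_scalar dotvE. Qed.

Lemma mulmx_block_consv s r t A a u :
  (block_mx s%:M r^T t A : 'M[R]_(1 + n)) *m consv a u =
  consv (s * a + dotv r u) (a *: t + A *m u).
Proof.
rewrite /consv (@mul_block_col _ 1 n 1 n 1) mulmx_row_scalar -scalar_mxM -raddfD /=.
by rewrite mul_mx_scalar.
Qed.

Lemma block_split (S : 'M[R]_(1 + n)) : exists s r t A, S = block_mx s%:M r^T t A.
Proof.
exists (ulsubmx S 0 0), (ursubmx S)^T, (dlsubmx S), (drsubmx S).
by rewrite -mx11_scalar trmxK submxK.
Qed.

Lemma sym_block_split (S : 'M[R]_(1 + n)) :
  S^T = S -> exists s r A, S = block_mx s%:M r^T r A /\ A^T = A.
Proof.
have [s [r [t [A ->]]]] := block_split S.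
rewrite (@tr_block_mx _ 1 n 1 n) => /(@eq_block_mx _ 1 n 1 n) [_ _ e eA].
by exists s, r, A; split => //; rewrite -e trmxK.
Qed.

(* [expR (gexp S l g)] times the standard Gaussian density is, up to a constant,
   [expR (- g.S g / 2 + l.g)]. *)
Definition gexp (m : nat) (S : 'M[R]_m) (l g : 'cV[R]_m) : R :=
  (sqnorm g - dotv g (S *m g)) / 2 + dotv l g.

Variables (s : R) (r : 'cV[R]_n) (A : 'M[R]_n).
Hypothesis s_gt0 : 0 < s.
Let S : 'M[R]_(1 + n) := block_mx s%:M r^T r A.

Definition schur : 'M[R]_n := A - s^-1 *: (r *m r^T).

Lemma mulmx_schur u : schur *m u = A *m u - (s^-1 * dotv r u) *: r.
Proof.
rewrite mulmxBl -scalemxAl -mulmxA mulmx_row_scalar mul_mx_scalar.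
by rewrite scalerA.
Qed.

Lemma schur_sym : A^T = A -> schur^T = schur.
Proof. by move=> As; rewrite linearB linearZ /= trmx_mul trmxK As. Qed.

(** For fixed [u], the first coordinate [- (r.u) / s] minimises the quadratic form of [S], and the
    minimum is the form of the Schur complement. *)
Lemma schur_coercive (c : R) :
  0 < c -> (forall w : 'cV[R]_(1 + n), c * sqnorm w <= dotv w (S *m w)) ->
  forall u, c * sqnorm u <= dotv u (schur *m u).
Proof.
move=> c0 S_ge u; have := S_ge (consv (- (dotv r u / s)) u).
rewrite mulmx_block_consv /sqnorm !dotv_consv mulmx_schur !dotvS (dotvC u r).
set x := dotv r u; set q := dotv u _; set N := dotv u u.
move=> h; apply: le_trans (le_trans h _).
  by rewrite ler_pM2l // mulrNN lerDr -expr2 sqr_ge0.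
by rewrite le_eqVlt; apply/orP; left; apply/eqP; field; rewrite gt_eqF.
Qed.

(** Isolates the first coordinate [g] in the shape integrated by [integral_normal_prob_expR], with
    [q = s]. *)
Lemma gexp_consv a u g h :
  gexp S (consv a u) (consv g h) =
  (1 - s) / 2 * g ^+ 2 + (a - dotv r h) * g +
  ((sqnorm h - dotv h (A *m h)) / 2 + dotv u h).
Proof.
by rewrite /gexp mulmx_block_consv /sqnorm !dotv_consv !dotvS (dotvC h r); field.
Qed.

(** What remains after integrating the first coordinate is again a [gexp], one dimension lower and
    with a shifted linear term. *)
Lemma gexp_schur a u h :
  (a - dotv r h) ^+ 2 / (2 * s) + ((sqnorm h - dotv h (A *m h)) / 2 + dotv u h) =
  a ^+ 2 / (2 * s) + gexp schur (u - (a / s) *: r) h.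
Proof.
by rewrite /gexp mulmx_schur !dotvS (dotvC h r); field; rewrite gt_eqF.
Qed.

Variables (x : R) (z t : 'cV[R]_n) (B : 'M[R]_n).
Let X : 'M[R]_(1 + n) := block_mx x%:M z^T t B.
Hypothesis SX : S *m X = 1%:M.

Let SX_block : [/\ s * x + dotv r t = 1, s *: z^T + r^T *m B = 0 & r *m z^T + A *m B = 1%:M].
Proof.
move: SX; rewrite /S /X (@mulmx_block _ 1 n 1 n 1 n) scalar_mx_block.
move=> /(@eq_block_mx _ 1 n 1 n)[e1 e2 _ e4]; split=> //.
- have := congr1 (fun M : 'M[R]_1 => M 0 0) e1.
  by rewrite mulmx_row_scalar -scalar_mxM -raddfD /= !mxE.
- by rewrite -mul_scalar_mx.
Qed.

Let XS_block : s *: t + B *m r = 0.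
Proof.
have := mulmx1C SX; rewrite /S /X (@mulmx_block _ 1 n 1 n 1 n) scalar_mx_block.
by move=> /(@eq_block_mx _ 1 n 1 n)[_ _ + _]; rewrite mul_mx_scalar.
Qed.

(** The upper right block of [S X = 1] gives [r^T B = - s z^T], which turns the product into the
    lower right block. *)
Lemma schur_inv : schur *m B = 1%:M.
Proof.
have [_ e <-] := SX_block.
rewrite mulmxBl -scalemxAl -mulmxA; move/eqP: e; rewrite addrC addr_eq0 => /eqP ->.
rewrite mulmxN scalerN opprK -scalemxAr scalerA mulVf ?gt_eqF // scale1r.
by rewrite addrC.
Qed.

Let tE : t = - (s^-1 *: (B *m r)).
Proof.
move/eqP: XS_block; rewrite addr_eq0 => /eqP e.
by rewrite -scalerN; rewrite -[in RHS](opprK (B *m r)) -e opprK scalerA mulVf ?gt_eqF // scale1r.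
Qed.

Lemma block_inv_ul : x = s^-1 + s^-1 ^+ 2 * dotv r (B *m r).
Proof.
have [e _ _] := SX_block; move: e; rewrite tE !dotvS => e.
have -> : x = s^-1 * (s * x) by rewrite mulKf ?gt_eqF.
by rewrite -[s * x](addrK (- (s^-1 * dotv r (B *m r)))) e; ring.
Qed.

(** The shift of [u] is the one in [gexp_schur], so the linear terms of the exponents match in the
    induction. *)
Lemma block_inv_dotv a u :
  dotv (consv a u) (X *m consv a u) =
  a ^+ 2 / s + dotv (u - (a / s) *: r) (B *m (u - (a / s) *: r)).
Proof.
have [_ e _] := SX_block.
have zu : dotv z u = - (s^-1 * dotv r (B *m u)).
  have := congr1 (fun M : 'rV[R]_n => (M *m u) 0 0) e.
  rewrite mulmxDl mul0mx -scalemxAl -mulmxA !mulmx_row_scalar !mxE /= !mulr1n => h.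
  have -> : dotv z u = s^-1 * (s * dotv z u) by rewrite mulKf ?gt_eqF.
  by move/eqP: h; rewrite addr_eq0 => /eqP ->; rewrite mulrN.
rewrite mulmx_block_consv dotv_consv zu block_inv_ul tE mulmxBr -scalemxAr !dotvS.
by field; rewrite gt_eqF.
Qed.

Lemma block_inv_mxtrace : \tr X = x + \tr B.
Proof. by rewrite /X (@mxtrace_block _ 1 n) mxtrace_scalar. Qed.

End SchurComplement.

(** * Measurability of random vectors *)

Section MeasurableVectors.
Context (d : measure_display) (T : measurableType d) (R : realType) (n : nat).
Implicit Types (u v : T -> 'cV[R]_n).

Definition measurable_vec u := forall i, measurable_fun setT (fun w => u w i 0).

Lemma measurable_vec_cst (v : 'cV[R]_n) : measurable_vec (fun=> v).
Proof. by move=> i; exact: measurable_cst. Qed.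

Lemma measurable_vecD u v :
  measurable_vec u -> measurable_vec v -> measurable_vec (fun w => u w + v w).
Proof.
move=> mu mv i; under eq_fun do rewrite mxE.
exact: measurable_funD.
Qed.

Lemma measurable_vecM (A : 'M[R]_n) v :
  measurable_vec v -> measurable_vec (fun w => A *m v w).
Proof.
move=> mv i; under eq_fun do rewrite mxE.
by apply: measurable_sum => k; apply: measurable_funM.
Qed.

Lemma measurable_dotv u v :
  measurable_vec u -> measurable_vec v -> measurable_fun setT (fun w => dotv (u w) (v w)).
Proof. by move=> mu mv; apply: measurable_sum => k; apply: measurable_funM. Qed.

Lemma measurable_gexp (S : 'M[R]_n) l v :
  measurable_vec v -> measurable_fun setT (fun w => gexp S l (v w)).
Proof.
move=> mv; apply: measurable_funD.
  apply: measurable_funM => //; apply: measurable_funB; first exact: measurable_dotv.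
  by apply: measurable_dotv => //; exact: measurable_vecM.
by apply: measurable_dotv => //; exact: measurable_vec_cst.
Qed.

End MeasurableVectors.

(** * Exponential moments of Gaussian quadratic forms *)

Section GaussianQuadratic.
Context (d : measure_display) (T : measurableType d) (R : realType).
Variables (P : probability T R) (sigma : R).
Hypothesis sigma_gt0 : 0 < sigma.

Definition stdv (n : nat) (xi : 'I_n -> T -> R) (w : T) : 'cV[R]_n :=
  \col_i (xi i w / sigma).

(** After squaring, this is [1 + z <= expR z] at [z = s^-1 - 1]. It trades the determinant factor of
    one pivot for a trace term. *)
Lemma sqrt_inv_le_expR (s : R) : 0 < s -> (Num.sqrt s)^-1 <= expR ((s^-1 - 1) / 2).
Proof.
move=> s0; rewrite -(ler_pXn2r (n := 2)) ?nnegrE ?expR_ge0 ?invr_ge0 ?sqrtr_ge0 //.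
rewrite exprVn sqr_sqrtr ?(ltW s0) // -expRM_natl.
by apply: le_trans (expR_ge1Dx _); rewrite le_eqVlt; apply/orP; left; apply/eqP; field; rewrite gt_eqF.
Qed.

(* One coordinate is integrated out at a time: this replaces [S] by the Schur
   complement of its corner entry, whose inverse is a block of [X]. *)
Lemma integral_gaussian_quadratic (n : nat) (xi : 'I_n -> T -> R)
    (S X : 'M[R]_n) (l : 'cV[R]_n) (c : R) :
  (forall i, measurable_fun setT (xi i)) ->
  (forall i (B : set R), measurable B -> P (xi i @^-1` B) = normal_prob 0 sigma B) ->
  mutually_independent P xi ->
  0 < c -> S^T = S -> (forall v, c * sqnorm v <= dotv v (S *m v)) ->
  S *m X = 1%:M ->
  (\int[P]_w (expR (gexp S l (stdv xi w)))%:E <=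
   (expR ((\tr X - n%:R) / 2 + dotv l (X *m l) / 2))%:E)%E.
Proof.
elim: n => [|n IH] in xi S X l *.
  move=> _ _ _ _ _ _ _.
  under eq_integral do rewrite /gexp /sqnorm /dotv !big_ord0 subrr mul0r addr0 expR0.
  rewrite integral_cst //= probability_setT mule1 /mxtrace /dotv !big_ord0.
  by rewrite subrr mul0r addr0 expR0.
move=> mxi lxi ixi c0 Ss S_ge SX.
have [s [r [A [eS As]]]] := sym_block_split Ss.
have [x [z [t [B eX]]]] := block_split X.
have [a [u el]] := consv_split l.
subst S X l.
have s0 : 0 < s.
  have := S_ge (consv 1 0); rewrite mulmx_block_consv /sqnorm !dotv_consv -(scale0r 0).
  rewrite !dotvS !mul0r !addr0 !mulr1 mul1r; exact: lt_le_trans.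
pose Y i := xi (lift ord0 i).
pose G := rectangles Y; pose TG := g_sigma_algebraType G.
have mY i : measurable_fun setT (Y i) by exact: mxi.
have stdvE w : stdv xi w = consv (xi ord0 w / sigma) (stdv Y w).
  apply/matrixP => i j; rewrite ord1 !mxE; case: splitP => k ek.
    rewrite !mxE ord1 mulr1n; congr (xi _ _ / _); apply: val_inj.
    by rewrite /= ek ord1.
  by rewrite !mxE; congr (xi _ _ / _); apply: val_inj; rewrite /= ek.
have mYG : measurable_vec (stdv Y : TG -> 'cV[R]_n).
  move=> i; under eq_fun do rewrite mxE.
  apply: measurable_funM => //; exact: measurable_fun_rectangles.
pose K (w : T) : R := (sqnorm (stdv Y w) - dotv (stdv Y w) (A *m stdv Y w)) / 2 + dotv u (stdv Y w).
(* The second component is the sample point itself; [TG] is [T] with only the sigma-algebra of the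
   remaining coordinates. *)
pose h (p : measurableTypeR R * TG) : \bar R :=
  (expR ((1 - s) / 2 * (p.1 / sigma) ^+ 2 +
    (a - dotv r (stdv Y p.2)) * (p.1 / sigma) + K p.2))%:E.
have mh : measurable_fun setT h.
  have mx : measurable_fun setT (fun p : measurableTypeR R * TG => p.1 / sigma).
    by apply: measurable_funM => //; exact: measurable_fst.
  have mv : measurable_vec (fun p : measurableTypeR R * TG => stdv Y p.2).
    by move=> i; apply: measurableT_comp (mYG i) _; exact: measurable_snd.
  apply/measurable_EFinP/measurableT_comp => //; apply: measurable_funD.
    apply: measurable_funD.
      by apply: measurable_funM => //; exact: measurable_funX.
    apply: measurable_funM => //; apply: measurable_funB => //.
    by apply: measurable_dotv => //; exact: measurable_vec_cst.
  exact: (measurable_gexp A u mv).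
have sGm : <<s G >> `<=` measurable.
  by apply: smallest_sub; [exact: sigma_algebra_measurable|exact: rectangles_measurable].
have mid : measurable_fun setT (id : T -> TG).
  by move=> _ E mE; rewrite setTI; exact: sGm.
have mx0 : measurable_fun setT (xi ord0 : T -> measurableTypeR R) by exact: mxi.
pose X0 : {mfun T >-> measurableTypeR R} :=
  HB.pack (xi ord0 : T -> measurableTypeR R) (isMeasurableFun.Build _ _ _ _ _ mx0).
pose idG : {mfun T >-> TG} := HB.pack (id : T -> TG) (isMeasurableFun.Build _ _ _ _ _ mid).
pose l' := u - (a / s) *: r.
have sq0 : 0 < Num.sqrt s by rewrite sqrtr_gt0.
have inner w : (\int[distribution P X0]_x h (x, w) =
   ((Num.sqrt s)^-1 * expR (a ^+ 2 / (2 * s)))%:E *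
   (expR (gexp (schur s r A) l' (stdv Y w)))%:E)%E.
  rewrite (eq_measure_integral (normal_prob 0 sigma)); last first.
    by move=> E mE _; exact: lxi.
  rewrite /h /=; under eq_integral do rewrite expRD EFinM.
  rewrite ge0_integralZr //=; last first.
    apply/measurable_EFinP/measurableT_comp => //; apply: measurable_funD.
      apply: measurable_funM => //; apply: measurable_funX.
      exact: measurable_funM.
    by apply: measurable_funM => //; exact: measurable_funM.
  rewrite integral_normal_prob_expR // -!EFinM -[in LHS]mulrA -[in RHS]mulrA -!expRD.
  by rewrite [in LHS](gexp_schur r A s0 a u (stdv Y w)).
have -> : (\int[P]_w (expR (gexp (block_mx s%:M r^T r A) (consv a u) (stdv xi w)))%:E =
   \int[P]_w h (X0 w, idG w))%E.
  by apply: eq_integral => w _; rewrite /h stdvE gexp_consv.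
rewrite ge0_integral_indep //; last 2 first.
- by move=> E F mE mF; exact: mutually_independent_rectangles.
- by move=> p; rewrite lee_fin expR_ge0.
under eq_integral do rewrite inner.
rewrite ge0_integralZl //=; last first.
  apply/measurable_EFinP/measurableT_comp => //; apply: measurable_gexp.
  by move=> i; under eq_fun do rewrite mxE; apply: measurable_funM => //; exact: mY.
have := IH Y (schur s r A) B l' mY (fun i => lxi _) (mutually_independent_behead ixi)
  c0 (schur_sym s r As) (schur_coercive s0 c0 S_ge) (schur_inv s0 SX).
move=> /(lee_pmul (_ : 0 <= ((Num.sqrt s)^-1 * expR (a ^+ 2 / (2 * s)))%:E)%E) IH'.
apply: (le_trans (IH' _ _ _ (lexx _))).
- by rewrite lee_fin mulr_ge0 ?expR_ge0 // invr_ge0 ltW.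
- by apply: integral_ge0 => w _; rewrite lee_fin expR_ge0.
rewrite -EFinM lee_fin.
(* The corner of the inverse is at least the reciprocal of the pivot, so its share [(x - 1) / 2] of
   the trace term pays for the factor [(Num.sqrt s)^-1]. *)
have xs : s^-1 <= x.
  rewrite (block_inv_ul s0 SX) lerDl mulr_ge0 ?sqr_ge0 //.
  exact: (coercive_inv_dotv_ge0 c0 (schur_coercive s0 c0 S_ge) (schur_inv s0 SX)).
apply: (@le_trans _ _ (expR ((x - 1) / 2) * expR (a ^+ 2 / (2 * s)) *
  expR ((\tr B - n%:R) / 2 + dotv l' (B *m l') / 2))).
  rewrite ler_pM2r ?expR_gt0 // ler_pM2r ?expR_gt0 //.
  apply: (le_trans (sqrt_inv_le_expR s0)).
  by rewrite ler_expR ler_pM2r // lerB.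
rewrite -!expRD ler_expR (block_inv_dotv s0 SX) block_inv_mxtrace -/l' -natr1.
by rewrite le_eqVlt; apply/orP; left; apply/eqP; field; rewrite gt_eqF.
Qed.

End GaussianQuadratic.

(** * Bounding the Chernoff exponent *)

Section ChernoffExponent.
Variables (R : realType) (n : nat) (D : 'M[R]_n).
Hypothesis D_sym : D^T = D.
Hypothesis D_dotv : forall w, - sqnorm w <= dotv w (D *m w) <= sqnorm w.
Hypothesis D_contr : forall w, sqnorm (D *m w) <= sqnorm w.

(* The values of [S] and [l] for which [gexp S l g] is, up to a constant, [1/64]
   of the deviation [2 g.D g + 2 g.v - |D g + v|^2 / 2]: see [gexp_chernoff]. *)
Definition chernoff_mx : 'M[R]_n := 1%:M - 16^-1 *: D + 64^-1 *: (D *m D).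
Definition chernoff_vec (v : 'cV[R]_n) : 'cV[R]_n := 64^-1 *: (2 *: v - D *m v).

Lemma chernoff_mx_sym : chernoff_mx^T = chernoff_mx.
Proof.
by rewrite /chernoff_mx linearD linearB !linearZ /= trmx1 trmx_mul D_sym.
Qed.

Lemma dotv_sym_sqr w : dotv w (D *m (D *m w)) = sqnorm (D *m w).
Proof. by rewrite /sqnorm [RHS]dotv_adj D_sym. Qed.

Lemma dotv_chernoff_mx w :
  dotv w (chernoff_mx *m w) =
  sqnorm w - 16^-1 * dotv w (D *m w) + 64^-1 * sqnorm (D *m w).
Proof.
rewrite /chernoff_mx mulmxDl mulmxBl mul1mx -!scalemxAl -mulmxA !dotvS.
by rewrite dotv_sym_sqr.
Qed.

Lemma chernoff_mx_coercive w : 15 / 16 * sqnorm w <= dotv w (chernoff_mx *m w).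
Proof.
rewrite dotv_chernoff_mx; have /andP[_] := D_dotv w.
by have := sqnorm_ge0 (D *m w); lra.
Qed.

(** Expand the square; the cross term uses [- w.D w <= |w|^2] and the last one [|D w| <= |w|]. *)
Lemma sqnorm_affine_le (a : R) w : 0 <= a ->
  sqnorm (a *: w - D *m w) <= (a + 1) ^+ 2 * sqnorm w.
Proof.
move=> a0; have /andP[h _] := D_dotv w; have := D_contr w.
rewrite /sqnorm !dotvS (dotvC (D *m w) w) -/(sqnorm w) -/(sqnorm (D *m w)).
by move: h => /(ler_wpM2l a0); lra.
Qed.

(* [X = 1 + B + B X B] for [B = 1 - chernoff_mx] and [X] the inverse. *)
Lemma chernoff_exponent_le (X : 'M[R]_n) (v : 'cV[R]_n) :
  chernoff_mx *m X = 1%:M ->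
  (\tr X - n%:R) / 2 + dotv (chernoff_vec v) (X *m chernoff_vec v) / 2 <=
  64^-1 * (2 * \tr D - \tr (D *m D) / 4 + sqnorm v / 2).
Proof.
move=> SX.
have c0 : 0 < 15 / 16 :> R by lra.
have X_le := coercive_inv_dotv_le c0 chernoff_mx_coercive SX.
pose B := 16^-1 *: D - 64^-1 *: (D *m D).
have SE : chernoff_mx = 1%:M - B by rewrite /chernoff_mx /B opprB addrA addrAC.
have XB : X = 1%:M + X *m B.
  have := mulmx1C SX; rewrite SE mulmxBr mulmx1 => <-.
  by rewrite subrK.
have BX : X = 1%:M + B + B *m (X *m B).
  have := SX; rewrite SE mulmxBl mul1mx => /eqP; rewrite subr_eq => /eqP {1}->.
  by rewrite {1}XB mulmxDr mulmx1 addrA.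
have Bs : B^T = B by rewrite /B linearB !linearZ /= trmx_mul D_sym.
(* Column by column: [16 / 15] bounds the form of [X], and [B = (4 D - D^2) / 64] yields
   [((4 + 1) / 64)^2 = 25 / 4096]. *)
have trBXB : \tr (B *m (X *m B)) <= 16 / 15 * (25 / 4096) * \tr (D *m D).
  rewrite -{1}Bs -{1}D_sym !mxtrace_gram mulr_sumr; apply: ler_sum => j _.
  have Bj : col j B = 64^-1 *: (4 *: col j D - D *m col j D).
    rewrite /B linearB !linearZ /= col_mul scalerBr scalerA.
    by rewrite scalerN; congr (_ *: _ + _); field.
  have := X_le (col j B); rewrite -col_mul [X in _ <= sqnorm X -> _]Bj.
  have := sqnorm_affine_le (col j D) (ler0n R 4).
  rewrite /sqnorm !(dotvZl, dotvZr); lra.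
have trX : \tr X = n%:R + (16^-1 * \tr D - 64^-1 * \tr (D *m D)) + \tr (B *m (X *m B)).
  rewrite {1}BX mxtraceD mxtraceD mxtrace1; congr (_ + _ + _).
  by rewrite raddfB /= !mxtraceZ.
(* Likewise [9 / 4096 = ((2 + 1) / 64)^2], from [2 v - D v]. *)
have l_le : dotv (chernoff_vec v) (X *m chernoff_vec v) <= 16 / 15 * (9 / 4096) * sqnorm v.
  have := X_le (chernoff_vec v); rewrite [X in _ <= sqnorm X -> _]/chernoff_vec.
  have := sqnorm_affine_le v (ler0n R 2).
  rewrite /sqnorm !(dotvZl, dotvZr); lra.
have trDD : 0 <= \tr (D *m D).
  by rewrite -{1}D_sym mxtrace_gram; apply: sumr_ge0 => j _; exact: sqnorm_ge0.
have := sqnorm_ge0 v; rewrite trX; lra.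
Qed.

Lemma gexp_chernoff (v g : 'cV[R]_n) :
  gexp chernoff_mx (chernoff_vec v) g =
  64^-1 * (2 * dotv g (D *m g) + 2 * dotv g v - sqnorm (D *m g + v) / 2
    + sqnorm v / 2).
Proof.
rewrite /gexp dotv_chernoff_mx /chernoff_vec /sqnorm !dotvS !(dotvC (D *m v)) !(dotvC v).
rewrite (_ : dotv g (D *m v) = dotv (D *m g) v); last by rewrite [RHS]dotv_adj D_sym.
by field.
Qed.

End ChernoffExponent.

(** * The penalised criterion on the simplex *)

Section Aggregate.
Variables (R : realType) (n M : nat) (A : 'I_M -> 'M[R]_n) (b : 'I_M -> 'cV[R]_n).
Variables (y : 'cV[R]_n) (s2 : R).
Let mu j := mu_j A b y j.

Lemma mu_thE theta : mu_th A b y theta = \sum_j theta j *: mu j.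
Proof.
rewrite /mu_th /A_th /b_th mulmx_suml -big_split /=; apply: eq_bigr => j _.
by rewrite -scalemxAl -scalerDr.
Qed.

Lemma dotv_mu_th u theta :
  dotv u (mu_th A b y theta) = \sum_j theta j * dotv u (mu j).
Proof. by rewrite mu_thE dotv_sumr; apply: eq_bigr => j _; rewrite dotvZr. Qed.

Lemma sum_simplex_cst theta (c : R) : in_simplex theta -> \sum_(j < M) theta j * c = c.
Proof. by move=> [_ th1]; rewrite -mulr_suml th1 mul1r. Qed.

Lemma sum_simplex_sqnormB theta u : in_simplex theta ->
  \sum_j theta j * sqnorm (u - mu j) =
  sqnorm u - 2 * dotv u (mu_th A b y theta) + \sum_j theta j * sqnorm (mu j).
Proof.
move=> th; rewrite dotv_mu_th mulr_sumr -[X in _ = X - _ + _](sum_simplex_cst _ th).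
rewrite -sumrB -big_split /=; apply: eq_bigr => j _.
by rewrite sqnormB; ring.
Qed.

Definition lincost j : R := sqnorm (mu j) / 2 - 2 * dotv y (mu j) + 2 * s2 * \tr (A j).

(** The penalty equals the average of [|mu_j|^2] minus [|mu_theta|^2], so half of it cancels half of
    the leading square and the rest is linear. *)
Lemma WpenE theta : in_simplex theta ->
  Wpen A b y s2 theta =
  sqnorm (mu_th A b y theta) / 2 + \sum_j theta j * lincost j.
Proof.
move=> th; rewrite /Wpen /pen (sum_simplex_sqnormB _ th).
have -> : \tr (A_th A theta) = \sum_j theta j * \tr (A j).
  by rewrite /A_th raddf_sum; apply: eq_bigr => j _; rewrite /= mxtraceZ.
have -> : \sum_j theta j * lincost j = (\sum_j theta j * sqnorm (mu j)) / 2 -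
    2 * dotv y (mu_th A b y theta) + 2 * s2 * \sum_j theta j * \tr (A j).
  rewrite dotv_mu_th mulr_suml !mulr_sumr -sumrB -big_split /=.
  by apply: eq_bigr => j _; rewrite /lincost; ring.
by rewrite -/(sqnorm _); field.
Qed.

Definition vertex (k : 'I_M) : 'I_M -> R := fun j => (j == k)%:R.

Lemma sum_vertex (k : 'I_M) (F : 'I_M -> R) : \sum_j vertex k j * F j = F k.
Proof.
rewrite (bigD1 k) //= /vertex eqxx mul1r big1 ?addr0 // => j /negbTE ->.
by rewrite mul0r.
Qed.

Lemma mu_vertex k : mu_th A b y (vertex k) = mu k.
Proof.
rewrite mu_thE (bigD1 k) //= /vertex eqxx scale1r big1 ?addr0 // => j /negbTE ->.
by rewrite scale0r.
Qed.

Lemma simplex_segment theta k t : in_simplex theta -> 0 <= t <= 1 ->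
  in_simplex (fun j => (1 - t) * theta j + t * vertex k j).
Proof.
move=> [th0 th1] /andP[t0 t1]; split=> [j|].
  by rewrite addr_ge0 // mulr_ge0 ?subr_ge0 // ler0n.
rewrite big_split /= -!mulr_sumr th1.
have := sum_vertex k (fun=> 1); under eq_bigr do rewrite mulr1.
by move=> ->; ring.
Qed.

(* Along the segment from [theta] to the vertex [k], [Wpen] is a quadratic
   polynomial with second-order coefficient [|mu_theta - mu_k|^2 / 2], and its
   slope at the minimiser is nonnegative. *)
Lemma Wpen_min_vertex theta k : in_simplex theta ->
  (forall theta', in_simplex theta' -> Wpen A b y s2 theta <= Wpen A b y s2 theta') ->
  Wpen A b y s2 theta + sqnorm (mu_th A b y theta - mu k) / 2 <=
  sqnorm (mu k) / 2 + lincost k.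
Proof.
move=> th thmin; set q := sqnorm (_ - _); set W := Wpen _ _ _ _ _.
have q0 : 0 <= q by exact: sqnorm_ge0.
set V := sqnorm (mu k) / 2 + lincost k.
have step t : 0 <= t <= 1 -> t * W <= t * V - t * (1 - t) * q / 2.
  move=> t01; have ths := simplex_segment k th t01.
  have := thmin _ ths; rewrite -/W (WpenE ths).
  have -> : mu_th A b y (fun j => (1 - t) * theta j + t * vertex k j) =
      (1 - t) *: mu_th A b y theta + t *: mu k.
    rewrite -mu_vertex !mu_thE !scaler_sumr -big_split /=.
    by apply: eq_bigr => j _; rewrite [LHS]scalerDl !scalerA.
  have -> : \sum_j ((1 - t) * theta j + t * vertex k j) * lincost j =
      (1 - t) * (\sum_j theta j * lincost j) + t * lincost k.
    rewrite -[in RHS](sum_vertex k lincost) !mulr_sumr -big_split /=.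
    by apply: eq_bigr => j _; ring.
  rewrite sqnorm_segment -/q => h.
  have e := WpenE th; rewrite -/W in e.
  by move: h; rewrite /V e; lra.
rewrite leNgt; apply/negP; rewrite -subr_gt0; set e := (_ - V) => e0.
(* Here [e > 0] is the supposed violation. For [t > 0], [step] forces [e <= t q / 2], which fails at
   [t = e / (q + e)], a point of the segment. *)
have qe0 : 0 < q + e by lra.
have t01 : 0 <= e / (q + e) <= 1.
  by rewrite divr_ge0 ?ler_pdivrMr ?(ltW e0) ?(ltW qe0) //= mul1r lerDr.
have := step _ t01; set t := e / (q + e).
have t0 : 0 < t by rewrite divr_gt0.
have -> : t * V - t * (1 - t) * q / 2 = t * (V - (1 - t) * q / 2) by field.
rewrite ler_pM2l // => h.
have : e <= t * q / 2 by rewrite /e; lra.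
rewrite /t ler_pdivlMr // mulrAC ler_pdivlMr //.
have : 0 <= q * e by rewrite mulr_ge0 // ltW.
have : 0 < e * e by rewrite mulr_gt0.
lra.
Qed.

(** Average the bound by [C] with weights [theta] and add [Wpen_min_vertex]: the linear costs of
    [theta] and the products [mu_k.mu_theta] cancel, and the two halves of [|mu_theta|^2] add up. *)
Lemma aggregate_risk_le (f xi : 'cV[R]_n) theta k C : y = f + xi ->
  in_simplex theta ->
  (forall theta', in_simplex theta' -> Wpen A b y s2 theta <= Wpen A b y s2 theta') ->
  (forall j, 2 * dotv xi (mu j - mu k) - 2 * s2 * \tr (A j - A k)
     - sqnorm (mu j - mu k) / 2 <= C) ->
  sqnorm (mu_th A b y theta - f) <= sqnorm (mu k - f) + C.
Proof.
move=> yE th thmin hC; have [th0 _] := th.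
have dotvy v : dotv y v = dotv f v + dotv xi v by rewrite yE dotvDl.
have := Wpen_min_vertex k th thmin; rewrite (WpenE th).
have : \sum_j theta j * (2 * dotv xi (mu j - mu k) - 2 * s2 * \tr (A j - A k)
     - sqnorm (mu j - mu k) / 2) <= C.
  rewrite -(sum_simplex_cst C th); apply: ler_sum => j _.
  exact: ler_wpM2l.
have -> : \sum_j theta j * (2 * dotv xi (mu j - mu k) - 2 * s2 * \tr (A j - A k)
     - sqnorm (mu j - mu k) / 2) =
  - (\sum_j theta j * lincost j) - 2 * dotv f (mu_th A b y theta)
  - 2 * dotv xi (mu k) + 2 * s2 * \tr (A k)
  + dotv (mu k) (mu_th A b y theta) - sqnorm (mu k) / 2.
  rewrite !dotv_mu_th.
  rewrite -(sum_simplex_cst (2 * dotv xi (mu k)) th).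
  rewrite -(sum_simplex_cst (2 * s2 * \tr (A k)) th).
  rewrite -(sum_simplex_cst (sqnorm (mu k) / 2) th) mulr_sumr.
  rewrite -sumrN -!sumrB -!big_split /= -sumrB; apply: eq_bigr => j _.
  rewrite /lincost raddfB /= sqnormB dotvBr (dotvC (mu k) (mu j)).
  by rewrite dotvy; field.
rewrite /lincost !sqnormB (dotvC _ f) (dotvC (mu k) f) (dotvC (mu k) (mu_th _ _ _ _)).
rewrite dotvy; lra.
Qed.

End Aggregate.

(** * Tail bound for one pair of estimators *)

Section Tail.
Context (d : measure_display) (T : measurableType d) (R : realType).
Variables (P : probability T R) (sigma : R) (n : nat) (xi : 'I_n -> T -> R).
Hypothesis sigma_gt0 : 0 < sigma.
Hypothesis mxi : forall i, measurable_fun setT (xi i).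
Hypothesis lxi : forall i (B : set R), measurable B ->
  P (xi i @^-1` B) = normal_prob 0 sigma B.
Hypothesis ixi : mutually_independent P xi.
Variables (D : 'M[R]_n) (v : 'cV[R]_n).
Hypothesis D_sym : D^T = D.
Hypothesis D_dotv : forall w, - sqnorm w <= dotv w (D *m w) <= sqnorm w.
Hypothesis D_contr : forall w, sqnorm (D *m w) <= sqnorm w.

(** The variable [Z_jk] for one pair; the coefficient [sigma ^+ 2 / 4] of the last trace is twice
    the tolerated error [sigma ^+ 2 / 8] of the variance estimate. *)
Definition deviation (g : 'cV[R]_n) : R :=
  2 * dotv g (D *m g) + 2 * dotv g v - sqnorm (D *m g + v) / 2
  - 2 * sigma ^+ 2 * \tr D + sigma ^+ 2 / 4 * \tr (D *m D).

Lemma measurable_deviation : measurable_fun setT (fun w => deviation (\col_i xi i w)).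
Proof.
have mg : measurable_vec (fun w => \col_i xi i w).
  move=> i; under eq_fun do rewrite mxE.
  exact: mxi.
have mDg := measurable_vecM D mg.
have mDgv := measurable_vecD mDg (measurable_vec_cst v).
apply: measurable_funD => //; apply: measurable_funB => //; apply: measurable_funB.
  by apply: measurable_funD; apply: measurable_funM => //; apply: measurable_dotv.
by apply: measurable_funM => //; exact: measurable_dotv.
Qed.

Lemma integral_expR_deviation_le1 :
  (\int[P]_w (expR ((64 * sigma ^+ 2)^-1 * deviation (\col_i xi i w)))%:E <= 1)%E.
Proof.
pose u := sigma^-1 *: v.
(* Minus the bound of [chernoff_exponent_le], so that the final exponent is at most zero. *)
pose c := - (64^-1 * (2 * \tr D - \tr (D *m D) / 4 + sqnorm u / 2)).
have s0 : sigma != 0 by rewrite gt_eqF.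
have e w : (64 * sigma ^+ 2)^-1 * deviation (\col_i xi i w) =
    gexp (chernoff_mx D) (chernoff_vec D u) (stdv sigma xi w) + c.
  have -> : \col_i xi i w = sigma *: stdv sigma xi w.
    by apply/matrixP => i j; rewrite !mxE mulrC divfK.
  have vE : v = sigma *: u by rewrite scalerA divff // scale1r.
  rewrite gexp_chernoff // /deviation vE /c; move: (stdv _ _ _) => g.
  clearbody u; rewrite -scalemxAr -(scalerDr sigma) sqnormZ !(dotvZl, dotvZr).
  by field.
under eq_integral do rewrite e expRD EFinM.
rewrite ge0_integralZr //=; last first.
  apply/measurable_EFinP/measurableT_comp => //; apply: measurable_gexp => i.
  by under eq_fun do rewrite mxE; apply: measurable_funM.
have c0 : 0 < 15 / 16 :> R by lra.
have co := chernoff_mx_coercive D_sym D_dotv.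
have SX := mulmxV (coercive_unitmx c0 co).
have := integral_gaussian_quadratic sigma_gt0 (chernoff_vec D u) mxi lxi ixi c0
  (chernoff_mx_sym D_sym) co SX.
have := chernoff_exponent_le D_sym D_dotv D_contr u SX.
set a := (_ + _) => ac h.
apply: (@le_trans _ _ ((expR a)%:E * (expR c)%:E)%E).
  by rewrite lee_pmul2r ?lte_fin ?expR_gt0.
by rewrite -EFinM -expRD lee_fin -expR0 ler_expR /c subr_le0.
Qed.

Lemma deviation_tail (t : R) :
  (P [set w | (64 * sigma ^+ 2 * t <= deviation (\col_i xi i w))%R] <= (expR (- t))%:E)%E.
Proof.
pose Z : {RV P >-> R} := HB.pack (fun w => deviation (\col_i xi i w))
  (isMeasurableFun.Build _ _ _ _ _ measurable_deviation).
have k0 : 0 < 64 * sigma ^+ 2 by rewrite mulr_gt0 // exprn_gt0.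
have := chernoff Z (64 * sigma ^+ 2 * t) (_ : 0 < (64 * sigma ^+ 2)^-1).
rewrite invr_gt0 => /(_ k0) /le_trans; apply.
rewrite mulKf ?gt_eqF // -[leRHS]mul1e lee_pmul2r ?lte_fin ?expR_gt0 //.
rewrite /mmt_gen_fun unlock; under eq_integral do rewrite /= mulrC.
exact: integral_expR_deviation_le1.
Qed.

End Tail.

(** * Union bound and the oracle inequality *)

Lemma measure_bigsetU_le (d : measure_display) (T : measurableType d) (R : realType)
    (P : probability T R) (I : Type) (s : seq I) (F : I -> set T) :
  (forall i, measurable (F i)) ->
  measurable (\big[setU/set0]_(i <- s) F i) /\
  (P (\big[setU/set0]_(i <- s) F i) <= \sum_(i <- s) P (F i))%E.
Proof.
move=> mF; elim: s => [|i s [mU IH]]; first by rewrite !big_nil measure0.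
rewrite !big_cons; split; first exact: measurableU.
by apply: (le_trans (measureU2 _ (mF i) mU)); exact: leeD.
Qed.

Theorem theorem6p2 (R : realType) (d : measure_display) (T : measurableType d)
  (P : probability T R) (n M : nat) (sigma : R)
  (f : 'cV[R]_n) (xi : 'I_n -> T -> R)
  (A : 'I_M -> 'M[R]_n) (b : 'I_M -> 'cV[R]_n)
  (s2hat : T -> R) (thetahat : T -> 'I_M -> R) :
  (2 <= M)%N ->
  0 < sigma ->
  (forall i, measurable_fun setT (xi i)) ->
  (forall i (B : set R), measurable B -> P (xi i @^-1` B) = normal_prob 0 sigma B) ->
  mutually_independent P xi ->
  (forall j, A j = (A j)^T /\ A j *m A j = A j) ->
  measurable_fun setT s2hat ->
  let y := fun w : T => f + \col_i xi i w in
  let delta := P [set w | sigma ^+ 2 / 8 < `|sigma ^+ 2 - s2hat w| ] in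
  (delta < 1)%E ->
  (forall w, in_simplex (thetahat w) /\
     forall theta, in_simplex theta ->
       Wpen A b (y w) (s2hat w) (thetahat w) <= Wpen A b (y w) (s2hat w) theta) ->
  forall x : R, 0 < x ->
  exists E : set T, measurable E /\
    (1 - delta - (2 * expR (- x))%:E <= P E)%E /\
    forall w, E w ->
      ((sqnorm (mu_th A b (y w) (thetahat w) - f))%:E <=
       \big[Order.min/+oo%E]_(j < M) (sqnorm (mu_j A b (y w) j - f))%:E
       + (64 * sigma ^+ 2 * (x + 2 * ln M%:R))%:E)%E.
Proof.
move=> M2 sigma0 mxi lxi ixi projA ms2 y delta delta1 thmin x x0.
pose N := M%:R : R.
have N0 : 0 < N by rewrite ltr0n; apply: leq_trans M2.
(* The term [2 * ln N] pays for the union over [M ^ 2] pairs: [expR (- t)] is [expR (- x)] divided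
   by [M ^ 2]. *)
pose t := x + 2 * ln N.
pose D (p : 'I_M * 'I_M) := A p.1 - A p.2.
pose v (p : 'I_M * 'I_M) := D p *m f + (b p.1 - b p.2).
pose g w : 'cV[R]_n := \col_i xi i w.
pose Z p w := deviation sigma (D p) (v p) (g w).
pose Bp p := [set w | 64 * sigma ^+ 2 * t <= Z p w].
pose B0 := [set w | sigma ^+ 2 / 8 < `|sigma ^+ 2 - s2hat w|].
have D_sym p : (D p)^T = D p.
  by rewrite linearB /= -(projA p.1).1 -(projA p.2).1.
have mB0 : measurable B0.
  have mf : measurable_fun setT (fun w => `|sigma ^+ 2 - s2hat w|).
    by apply: measurableT_comp => //; exact: measurable_funB.
  rewrite -[B0]setTI (_ : B0 = (fun w => `|sigma ^+ 2 - s2hat w|) @^-1` `]sigma ^+ 2 / 8, +oo[%classic).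
    exact: mf.
  by apply/seteqP; split=> w; rewrite /= in_itv /= andbT.
have mBp p : measurable (Bp p).
  rewrite -[Bp p]setTI (_ : Bp p = Z p @^-1` `[64 * sigma ^+ 2 * t, +oo[%classic).
    exact: measurable_deviation.
  by apply/seteqP; split=> w; rewrite /= in_itv /= andbT.
have PBp p : (P (Bp p) <= (expR (- t))%:E)%E.
  apply: deviation_tail => // w.
    exact: orthoprojB_dotv_le.
  exact: orthoprojB_sqnorm_le.
pose U := \big[setU/set0]_(p <- index_enum ('I_M * 'I_M)%type) Bp p.
have [mU PU] := measure_bigsetU_le P (index_enum ('I_M * 'I_M)%type) mBp.
have PUle : (P U <= (expR (- x))%:E)%E.
  apply: (le_trans PU); apply: (@le_trans _ _ (\sum_(p : 'I_M * 'I_M) (expR (- t))%:E)%E).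
    by apply: lee_sum => p _; exact: PBp.
  have -> : expR (- t) = expR (- x) * (N^-1 * N^-1).
    rewrite /t (_ : - _ = - x + (- ln N - ln N)); last by lra.
    by rewrite !expRD (expRN (ln N)) lnK ?posrE.
  rewrite sumEFin sumr_const card_prod !card_ord lee_fin -mulr_natr natrM -/N.
  by rewrite -mulrA mulrACA mulVf ?gt_eqF // !mulr1.
exists (~` (B0 `|` U)).
have mBU : measurable (B0 `|` U) by exact: measurableU.
split; first exact: measurableC.
split.
  have PBU : (P (B0 `|` U) <= delta + (2 * expR (- x))%:E)%E.
    apply: (le_trans (measureU2 _ mB0 mU)); apply: leeD => //.
    apply: (le_trans PUle); rewrite lee_fin ler_peMl ?expR_ge0 //; lra.
  by rewrite probability_setC // -addeA -fin_num_oppeD //; exact: leeB.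
move=> w /not_orP[nB0 nU].
have Zlt p : Z p w <= 64 * sigma ^+ 2 * t.
  rewrite leNgt; apply/negP => Zp; apply: nU.
  by rewrite /U -bigcup_seq; exists p; [exact: mem_index_enum|exact: ltW].
have s2le : `|sigma ^+ 2 - s2hat w| <= sigma ^+ 2 / 8 by rewrite leNgt; apply/negP.
have [thw thw_min] := thmin w.
have key k : sqnorm (mu_th A b (y w) (thetahat w) - f) <=
    sqnorm (mu_j A b (y w) k - f) + 64 * sigma ^+ 2 * t.
  apply: (aggregate_risk_le (xi := g w) (s2 := s2hat w)) => // j.
  apply: le_trans (Zlt (j, k)); rewrite /Z /deviation.
  have -> : mu_j A b (y w) j - mu_j A b (y w) k = D (j, k) *m g w + v (j, k).
    rewrite /mu_j /v /y -/(g w) /D /= !mulmxDr !mulmxBl.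
    by apply/matrixP => i i'; rewrite !mxE; ring.
  have tr_le := orthoprojB_mxtrace_le (projA j) (projA k).
  rewrite dotvDr -/(D (j, k)).
  (* Replacing [s2hat w] by [sigma ^+ 2] costs twice this, which the last term of [deviation]
     absorbs. *)
  have : (sigma ^+ 2 - s2hat w) * \tr (D (j, k)) <= sigma ^+ 2 / 8 * \tr (D (j, k) *m D (j, k)).
    apply: (le_trans (ler_norm _)); rewrite normrM.
    by apply: ler_pM => //; exact: normr_ge0.
  lra.
(* With the constant moved to the left, a lower bound on the minimum is checked at the default [+oo]
   and at each [k]. *)
rewrite -leeBlDr //; elim/big_ind: _ => [|a c ha hc|k _]; first exact: leey.
  by rewrite le_min ha.
by rewrite leeBlDr // -EFinD lee_fin; exact: key.
Qed.
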